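(* Let $\mathbf P$ be a PLP-polymatroid (pruned lattice path polymatroid) on the ground set $[n]$ with set of bases $B$. Then $\mathbf P$ satisfies the two-sided strong symmetric exchange property.
   Context: $[n]=\{1,\dots,n\}$; $\boldsymbol\epsilon_1,\dots,\boldsymbol\epsilon_n$ is the canonical basis of $\mathbb Z^n$; $\mathbb Z_+$ is the set of non-negative integers, and $\mathbb Z_+^n$ is ordered componentwise. A discrete polymatroid on $[n]$ is a nonempty finite set $\mathbf P\subseteq\mathbb Z_+^n$ which is closed under passing to componentwise smaller vectors of $\mathbb Z_+^n$ and such that for $\mathbf u,\mathbf v\in\mathbf P$ with $\sum u_i<\sum v_i$ there is $i$ with $u_i<v_i$ and $\mathbf u+\boldsymbol\epsilon_i\in\mathbf P$. Its bases are its maximal elements. PLP-polymatroid: let $n,d$ be positive integers and $\mathbf a,\mathbf b,\boldsymbol\alpha,\boldsymbol\beta\in\mathbb Z_+^n$ with $\mathbf a\le\mathbf b$, $\boldsymbol\alpha\le\boldsymbol\beta$, $\alpha_1\le\cdots\le\alpha_n=d$, $\beta_1\le\cdots\le\beta_n=d$. A discrete polymatroid on $[n]$ is a PLP-polymatroid of type $(\mathbf a,\mathbf b|\boldsymbol\alpha,\boldsymbol\beta)$ if its set of bases consists of all $\mathbf u\in\mathbb Z_+^n$ with $a_i\le u_i\le b_i$ and $\alpha_i\le u_1+\cdots+u_i\le\beta_i$ for $i=1,\dots,n$. $\mathbf P$ (or $B$) satisfies the left-sided (respectively right-sided) strong symmetric exchange property if for all $\mathbf u,\mathbf v\in B$ and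 all $i$ with $u_i>v_i$ and $u_1+\cdots+u_{i-1}<v_1+\cdots+v_{i-1}$ (respectively $u_{i+1}+\cdots+u_n<v_{i+1}+\cdots+v_n$) there exists $j\le i-1$ (respectively $j\ge i+1$) such that $u_j<v_j$ and both $\mathbf u-\boldsymbol\epsilon_i+\boldsymbol\epsilon_j$ and $\mathbf v+\boldsymbol\epsilon_i-\boldsymbol\epsilon_j$ belong to $B$. The two-sided property means that both the left-sided and the right-sided properties hold. *)

(* Defs.v *)
From mathcomp Require Import all_boot finmap.

Set Implicit Arguments.
Unset Strict Implicit.
Unset Printing Implicit Defensive.

Local Open Scope nat_scope.

(* Vectors of Z_+^n are finite functions on 'I_n, so the element i of
   [n] = {1, ..., n} is represented by the ordinal of value i - 1. *)
Notation vec n := {ffun 'I_n -> nat}.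

Definition le_vec (n : nat) (u v : vec n) : bool := [forall i, u i <= v i].

Definition vsum (n : nat) (u : vec n) : nat := \sum_(k < n) u k.

Definition add_eps (n : nat) (u : vec n) (i : 'I_n) : vec n :=
  [ffun k => u k + (k == i)].

(* The truncated subtraction is a genuine one whenever 0 < u i, which holds
   at every use below: move_eps u i j occurs only with v i < u i, and
   move_eps v j i only with u j < v j. *)
Definition move_eps (n : nat) (u : vec n) (i j : 'I_n) : vec n :=
  [ffun k => u k - (k == i) + (k == j)].

Record discrete_polymatroid (n : nat) (P : {fset vec n}) : Prop :=
  DiscretePolymatroid {
    dpoly_nonempty : P != fset0;
    dpoly_down_closed : forall u v : vec n, v \in P -> le_vec u v -> u \in P;
    dpoly_augment : forall u v : vec n, u \in P -> v \in P ->
      vsum u < vsum v -> exists i : 'I_n, u i < v i /\ add_eps u i \in P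
  }.

Definition bases (n : nat) (P : {fset vec n}) : {fset vec n} :=
  [fset u in P | [forall v : P, le_vec u (val v) ==> (val v == u)]]%fset.

Record PLP_polymatroid_of_type (n d : nat) (a b alpha beta : vec n)
    (P : {fset vec n}) : Prop := PLPPolymatroidOfType {
  PLP_n_gt0 : 0 < n;
  PLP_d_gt0 : 0 < d;
  PLP_le_ab : le_vec a b;
  PLP_le_alpha_beta : le_vec alpha beta;
  PLP_alpha_mono : forall i j : 'I_n, i <= j -> alpha i <= alpha j;
  PLP_beta_mono : forall i j : 'I_n, i <= j -> beta i <= beta j;
  PLP_alpha_last : forall i : 'I_n, i.+1 = n -> alpha i = d;
  PLP_beta_last : forall i : 'I_n, i.+1 = n -> beta i = d;
  PLP_discrete_polymatroid : discrete_polymatroid P;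
  PLP_bases : forall u : vec n, u \in bases P <->
    (forall i : 'I_n, a i <= u i <= b i /\
       alpha i <= \sum_(k < n | k <= i) u k <= beta i)
}.

Definition PLP_polymatroid (n : nat) (P : {fset vec n}) : Prop :=
  exists (d : nat) (a b alpha beta : vec n),
    PLP_polymatroid_of_type d a b alpha beta P.

Definition left_strong_symmetric_exchange (n : nat) (B : {fset vec n}) : Prop :=
  forall (u v : vec n) (i : 'I_n), u \in B -> v \in B -> v i < u i ->
    \sum_(k < n | k < i) u k < \sum_(k < n | k < i) v k ->
    exists j : 'I_n, [/\ j < i, u j < v j,
      move_eps u i j \in B & move_eps v j i \in B].

Definition right_strong_symmetric_exchange (n : nat) (B : {fset vec n}) : Prop :=
  forall (u v : vec n) (i : 'I_n), u \in B -> v \in B -> v i < u i ->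
    \sum_(k < n | i < k) u k < \sum_(k < n | i < k) v k ->
    exists j : 'I_n, [/\ i < j, u j < v j,
      move_eps u i j \in B & move_eps v j i \in B].

Definition two_sided_strong_symmetric_exchange (n : nat) (B : {fset vec n}) :
    Prop :=
  left_strong_symmetric_exchange B /\ right_strong_symmetric_exchange B.

(* Main.v *)
Require Import Defs.
From mathcomp Require Import all_boot finmap.
From mathcomp Require Import zify.

(** For the left-sided property take the largest [j < i] with [u j < v j], and
    for the right-sided one the smallest [j > i].  Between [i] and [j] no
    coordinate of [u] is below that of [v], so the strict inequality between
    the partial sums of [u] and [v] given at [i] persists up to [j]: there the
    partial sums of [u] and [v] differ by at least one, in the direction in
    which the exchange moves them towards each other.  Hence the modified
    partial sums and coordinates stay between those of [u] and [v], where all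
    the bounds hold. *)

Definition prefix_sum {n : nat} (u : {ffun 'I_n -> nat}) (k : nat) : nat :=
  \sum_(l < n | l <= k) u l.

Definition in_lattice_path {n : nat} (a b alpha beta u : {ffun 'I_n -> nat}) :
    Prop :=
  forall i : 'I_n, a i <= u i <= b i /\ alpha i <= prefix_sum u i <= beta i.

Section Exchange.

Context {n : nat}.
Implicit Types (u v a b alpha beta : {ffun 'I_n -> nat}) (i j : 'I_n).

Lemma sum_eq_indicator (P : pred 'I_n) i : \sum_(l < n | P l) (l == i) = P i.
Proof.
case Pi: (P i); last first.
  by rewrite big1 // => l Pl; case: eqP Pl => // ->; rewrite Pi.
by rewrite (bigD1 i) //= eqxx big1 // => l /andP[_ /negPf ->].
Qed.

(** The removed unit is counted on the left instead of subtracted on the right, which keeps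
    truncated subtraction out of the later arithmetic. *)
Lemma prefix_sum_move_eps u i j k : 0 < u i ->
  prefix_sum (move_eps u i j) k + (i <= k) = prefix_sum u k + (j <= k).
Proof.
move=> ui; rewrite /prefix_sum.
rewrite -(sum_eq_indicator (fun l => l <= k) i).
rewrite -(sum_eq_indicator (fun l => l <= k) j) -!big_split /=.
apply: eq_bigr => l _; rewrite ffunE.
by case: (eqVneq l i) => [->|_] /=; [rewrite addnAC subnK|rewrite subn0 addn0].
Qed.

Lemma prefix_sum_split u i k : k < i ->
  \sum_(l < n | l < i) u l = prefix_sum u k + \sum_(l < n | k < l < i) u l.
Proof.
move=> ki; rewrite (bigID (fun l : 'I_n => l <= k)) /=.
by congr (_ + _); apply: eq_bigl => l; lia.
Qed.

Lemma prefix_sum_suffix u i : vsum u = prefix_sum u i + \sum_(l < n | i < l) u l.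
Proof.
rewrite /vsum (bigID (fun l : 'I_n => l <= i)) /=.
by congr (_ + _); apply: eq_bigl => l; lia.
Qed.

Lemma exists_lt_of_sum_lt (P : pred 'I_n) u v :
  \sum_(l < n | P l) u l < \sum_(l < n | P l) v l ->
  exists j, P j && (u j < v j).
Proof.
move=> lt_uv; apply/existsP; apply: contraLR lt_uv => /existsPn no_j.
rewrite -leqNgt; apply: leq_sum => l Pl.
by move: (no_j l); rewrite Pl -leqNgt.
Qed.

(** Swapping [u] with [v] and [i] with [j] permutes the hypotheses, so one statement covers both
    exchanged vectors, on either side; one of the two interval conditions is always vacuous. *)
Lemma move_eps_in_lattice_path a b alpha beta u v i j :
  in_lattice_path a b alpha beta u -> in_lattice_path a b alpha beta v ->
  v i < u i -> u j < v j ->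
  (forall k : 'I_n, j <= k < i -> prefix_sum u k < prefix_sum v k) ->
  (forall k : 'I_n, i <= k < j -> prefix_sum v k < prefix_sum u k) ->
  in_lattice_path a b alpha beta (move_eps u i j).
Proof.
move=> Lu Lv vui uvj lt_ji lt_ij k.
have [u_k Su_k] := Lu k; have [v_k Sv_k] := Lv k; split.
  rewrite ffunE; case: (eqVneq k i) => [ki|_]; case: (eqVneq k j) => [kj|_];
  by subst; lia.
have := prefix_sum_move_eps u i j k ltac:(lia).
move: (lt_ji k) (lt_ij k).
(* The partial sum at [k] drops by one if [i <= k < j], rises by one if [j <= k < i], and is
   unchanged otherwise. *)
case: (leqP i k) => ik; case: (leqP j k) => jk /=.
- by lia.
- by move=> _ /(_ isT); lia.
- by move=> /(_ isT) + _; lia.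
- by lia.
Qed.

Lemma left_exchange_index u v i :
  \sum_(k < n | k < i) u k < \sum_(k < n | k < i) v k ->
  exists j, [/\ j < i, u j < v j &
    forall k : 'I_n, j <= k < i -> prefix_sum u k < prefix_sum v k].
Proof.
move=> lt_uv; have [j0 Pj0] := exists_lt_of_sum_lt _ _ _ lt_uv.
case: (@arg_maxnP _ j0 (fun j => (j < i) && (u j < v j)) val Pj0).
move=> j /andP[ji uvj] maxj; exists j; split=> // k /andP[jk ki].
move: lt_uv; rewrite !(prefix_sum_split _ i k ki).
(* By maximality of [j], the deficit of [u] before [i] must already be present up to [k]. *)
have: \sum_(l < n | k < l < i) v l <= \sum_(l < n | k < l < i) u l.
  apply: leq_sum => l /andP[kl li]; rewrite leqNgt; apply/negP => uvl.
  by have := maxj l; rewrite li uvl /= => /(_ isT); lia.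
by lia.
Qed.

Lemma right_exchange_index u v i : vsum u = vsum v ->
  \sum_(k < n | i < k) u k < \sum_(k < n | i < k) v k ->
  exists j, [/\ i < j, u j < v j &
    forall k : 'I_n, i <= k < j -> prefix_sum v k < prefix_sum u k].
Proof.
move=> eq_uv lt_uv; have [j0 Pj0] := exists_lt_of_sum_lt _ _ _ lt_uv.
case: (@arg_minnP _ j0 (fun j => (i < j) && (u j < v j)) val Pj0).
move=> j /andP[ij uvj] minj; exists j; split=> // k /andP[ik kj].
have split_k (w : {ffun 'I_n -> nat}) : \sum_(l < n | i < l) w l =
    \sum_(l < n | i < l <= k) w l + \sum_(l < n | k < l) w l.
  rewrite (bigID (fun l : 'I_n => l <= k)) /=.
  by congr (_ + _); apply: eq_bigl => l; lia.
(* With equal totals, a deficit of [u] beyond [k] is an excess of its partial sum at [k]. *)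
move: eq_uv lt_uv; rewrite !split_k !(prefix_sum_suffix _ k).
have: \sum_(l < n | i < l <= k) v l <= \sum_(l < n | i < l <= k) u l.
  apply: leq_sum => l /andP[il lk]; rewrite leqNgt; apply/negP => uvl.
  by have := minj l; rewrite il uvl /= => /(_ isT); lia.
by lia.
Qed.

(** At the last index both bounds equal [d] and the partial sum is the whole sum. *)
Lemma PLP_vsum d a b alpha beta P u :
  PLP_polymatroid_of_type d a b alpha beta P ->
  in_lattice_path a b alpha beta u -> vsum u = d.
Proof.
move=> hP Lu; have n_gt0 := PLP_n_gt0 hP.
have lt_n : n.-1 < n by lia.
pose m := Ordinal lt_n; have m_last : m.+1 = n by rewrite /=; lia.
have := (Lu m).2; rewrite (PLP_alpha_last hP m_last) (PLP_beta_last hP m_last).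
rewrite (prefix_sum_suffix u m) [X in _ + X]big_pred0; first by lia.
by move=> l; have := ltn_ord l; rewrite /=; lia.
Qed.

End Exchange.

Theorem proposition2p4 (n : nat) (P : {fset {ffun 'I_n -> nat}})
    (hP : PLP_polymatroid P) :
  two_sided_strong_symmetric_exchange (bases P).
Proof.
case: hP => d [a [b [alpha [beta hP]]]].
have basesP u : u \in bases P <-> in_lattice_path a b alpha beta u.
  exact: PLP_bases hP u.
split=> u v i /basesP Lu /basesP Lv vui lt_uv.
  have [j [ji uvj lt_ji]] := left_exchange_index _ _ _ lt_uv.
  exists j; split=> //; apply/basesP.
    by apply: (move_eps_in_lattice_path _ _ _ _ u v) => // k; lia.
  by apply: (move_eps_in_lattice_path _ _ _ _ v u) => // k; lia.
have eq_uv : vsum u = vsum v by rewrite !(PLP_vsum _ _ _ _ _ _ _ hP).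
have [j [ij uvj lt_ij]] := right_exchange_index _ _ _ eq_uv lt_uv.
exists j; split=> //; apply/basesP.
  by apply: (move_eps_in_lattice_path _ _ _ _ u v) => // k; lia.
by apply: (move_eps_in_lattice_path _ _ _ _ v u) => // k; lia.
Qed.
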